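(* Let $N$ decision-making units with interval inputs $x_{ij}\in\mathcal{K}_C^{+}$ ($i=1,\dots,M$, $j=1,\dots,N$) and interval outputs $y_{rj}\in\mathcal{K}_C^{+}$ ($r=1,\dots,S$, $j=1,\dots,N$) be given, and let $p\in\{1,\dots,N\}$. Then $DMU_p$ is efficient if and only if $EI(X_p,Y_p)=0$, where $EI(X_p,Y_p)$ is the optimal value of the model (EINL).
   Context: Intervals: $\mathcal{K}_C=\{[\underline a,\overline a] : \underline a\le\overline a\in\mathbb{R}\}$. For $A=[\underline a,\overline a]$, $B=[\underline b,\overline b]$: $A+B=[\underline a+\underline b,\overline a+\overline b]$; $A-B=[\underline a-\overline b,\overline a-\underline b]$; $A\cdot B=\{ab: a\in A,b\in B\}$ (an interval); $\lambda A=[\lambda\underline a,\lambda\overline a]$ for real $\lambda\ge0$. $A\preceq B$ iff $\underline a\le\underline b$ and $\overline a\le\overline b$; $A\succeq B$ means $B\preceq A$; for vectors of intervals these operations and relations are taken componentwise. Real numbers $c$ are identified with $[c,c]$. $\mathcal{K}_C^{+}=\{A\in\mathcal{K}_C: A\succeq 0\}$. Data: $DMU_j$, $j=1,\dots,N$, has inputs $X_j=(x_{1j},\dots,x_{Mj})\in(\mathcal{K}_C^{+})^M$ and outputs $Y_j=(y_{1j},\dots,y_{Sj})\in(\mathcal{K}_C^{+})^S$, with $x_{ij}=[\underline{x_{ij}},\overline{x_{ij}}]$, $y_{rj}=[\underline{y_{rj}},\overline{y_{rj}}]$. The denominators $\underline{x_{ip}}+\overline{x_{ip}}$ and $\underline{y_{rp}}+\overline{y_{rp}}$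 in the objective function below are nonzero, so that it is well defined. Production possibility set (variable returns to scale): $$T_{IDEA}=\Big\{(x,y)\in(\mathcal{K}_C^{+})^{M+S} : \exists\,\lambda_1,\dots,\lambda_N\ge0,\ \sum_{j=1}^N\lambda_j=1,\ x\succeq\sum_{j=1}^N\lambda_jX_j,\ y\preceq\sum_{j=1}^N\lambda_jY_j\Big\}.$$ $DMU_p$ is efficient if and only if for every $(x,y)\in T_{IDEA}$ with $x\preceq X_p$ and $y\succeq Y_p$ one has $(x,y)=(X_p,Y_p)$. Model (EINL) for $DMU_p$: $EI(X_p,Y_p)$ is the maximum of $$\sum_{i=1}^{M}\frac{\underline{sl_i^x}+\underline{su_i^x}+\overline{sl_i^x}+\overline{su_i^x}}{\underline{x_{ip}}+\overline{x_{ip}}}+\sum_{r=1}^{S}\frac{\underline{sl_r^y}+\underline{su_r^y}+\overline{sl_r^y}+\overline{su_r^y}}{\underline{y_{rp}}+\overline{y_{rp}}}$$ over $\lambda_1,\dots,\lambda_N\ge0$ with $\sum_{j=1}^N\lambda_j=1$ and intervals $sl_i^x,su_i^x,sl_r^y,su_r^y\in\mathcal{K}_C^{+}$ subject to, for all $i=1,\dots,M$ and $r=1,\dots,S$: $\sum_{j=1}^N\lambda_j x_{ij}+sl_i^x=x_{ip}-su_i^x$; $\sum_{j=1}^N\lambda_j y_{rj}-su_r^y=y_{rp}+sl_r^y$; $sl_i^x\cdot su_i^x=0$ and $sl_r^y\cdot su_r^y=0$. *)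

(* Defs.v *)
From HB Require Import structures.
From mathcomp Require Import all_boot all_order all_algebra.
From mathcomp Require Import boolp classical_sets set_interval reals interval_inference.

Set Implicit Arguments.
Unset Strict Implicit.
Unset Printing Implicit Defensive.

Import Order.TTheory GRing.Theory Num.Theory.
Local Open Scope classical_set_scope.
Local Open Scope ring_scope.

Record KC (R : realType) := MkKC {
  KCval : R * R;
  _ : KCval.1 <= KCval.2 }.

HB.instance Definition _ (R : realType) := [isSub for @KCval R].
HB.instance Definition _ (R : realType) := [Choice of KC R by <:].

Section Intervals.
Context {R : realType}.
Implicit Types (A B : KC R) (l : {nonneg R}).

Definition lo A : R := (KCval A).1.
Definition hi A : R := (KCval A).2.

Lemma le_lo_hi A : lo A <= hi A.
Proof. by case: A. Qed.

Lemma KC_eq A B : lo A = lo B -> hi A = hi B -> A = B.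
Proof.
by case: A B => [[a b] h] [[c d] k]; rewrite /lo /hi /= => ab cd;
  apply: val_inj; rewrite /= ab cd.
Qed.

Definition mkKC (a b : R) (ab : a <= b) : KC R := @MkKC R (a, b) ab.

Definition KCpt (c : R) : KC R := mkKC (lexx c).

Definition KCadd A B : KC R := mkKC (lerD (le_lo_hi A) (le_lo_hi B)).

Fact KCaddA : associative KCadd.
Proof. by move=> A B C; apply: KC_eq; rewrite /lo /hi /= addrA. Qed.

Fact KCaddC : commutative KCadd.
Proof. by move=> A B; apply: KC_eq; rewrite /lo /hi /= addrC. Qed.

Fact KCadd0 : left_id (KCpt 0) KCadd.
Proof. by move=> A; apply: KC_eq; rewrite /lo /hi /= add0r. Qed.

(* Intervals form only a commutative monoid: [A - B] below is the endpoint
   difference, not the addition of an opposite. *)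
HB.instance Definition _ := GRing.isNmodule.Build (KC R) KCaddA KCaddC KCadd0.

Definition KCsub A B : KC R := mkKC (lerB (le_lo_hi A) (le_lo_hi B)).

Definition KCscale l A : KC R :=
  mkKC (ler_wpM2l (ge0 l) (le_lo_hi A)).

Definition KCset A : set R := [set` `[lo A, hi A]].

Definition KCmul A B : set R := [set a * b | a in KCset A & b in KCset B].

Definition KCle A B : bool := (lo A <= lo B) && (hi A <= hi B).

Definition KCpos A : bool := KCle (KCpt 0) A.

Definition KCvle (n : nat) (x y : 'I_n -> KC R) : Prop :=
  forall i, KCle (x i) (y i).

End Intervals.

Section Model.
Context {R : realType} {M S N : nat}.
Variables (X : 'I_N -> 'I_M -> KC R) (Y : 'I_N -> 'I_S -> KC R).

Definition combination (n : nat) (lam : 'I_N -> {nonneg R})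
    (Z : 'I_N -> 'I_n -> KC R) (i : 'I_n) : KC R :=
  \sum_(j < N) KCscale (lam j) (Z j i).

Definition T_IDEA : set (('I_M -> KC R) * ('I_S -> KC R)) :=
  [set xy | (forall i, KCpos (xy.1 i)) /\ (forall r, KCpos (xy.2 r)) /\
    exists lam : 'I_N -> {nonneg R},
      [/\ \sum_(j < N) (lam j)%:num = 1,
          KCvle (combination lam X) xy.1
        & KCvle xy.2 (combination lam Y)]].

Definition efficient (p : 'I_N) : Prop :=
  forall x y, T_IDEA (x, y) -> KCvle x (X p) -> KCvle (Y p) y ->
    (x, y) = (X p, Y p).

Record EINL_var := MkEINL {
  lam : 'I_N -> {nonneg R};
  slx : 'I_M -> KC R;
  sux : 'I_M -> KC R;
  sly : 'I_S -> KC R;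
  suy : 'I_S -> KC R }.

Definition EINL_feasible (p : 'I_N) : set EINL_var :=
  [set v |
    [/\ \sum_(j < N) (lam v j)%:num = 1,
        (forall i, KCpos (slx v i) /\ KCpos (sux v i)) /\
        (forall r, KCpos (sly v r) /\ KCpos (suy v r)),
        forall i, combination (lam v) X i + slx v i = KCsub (X p i) (sux v i),
        forall r, KCsub (combination (lam v) Y r) (suy v r) = Y p r + sly v r
      & (forall i, KCmul (slx v i) (sux v i) = KCset (KCpt 0)) /\
        (forall r, KCmul (sly v r) (suy v r) = KCset (KCpt 0))]].

Definition EINL_objective (p : 'I_N) (v : EINL_var) : R :=
  \sum_(i < M) (lo (slx v i) + lo (sux v i) + hi (slx v i) + hi (sux v i))
               / (lo (X p i) + hi (X p i)) +
  \sum_(r < S) (lo (sly v r) + lo (suy v r) + hi (sly v r) + hi (suy v r))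
               / (lo (Y p r) + hi (Y p r)).

(* [is_EI p e] reads "EI(X_p, Y_p) = e": the maximum exists and equals [e]. *)
Definition is_EI (p : 'I_N) (e : R) : Prop :=
  let values := [set EINL_objective p v | v in EINL_feasible p] in
  values e /\ ubound values e.

End Model.

(* Main.v *)
Require Import Defs.
From mathcomp Require Import all_boot all_order all_algebra.
From mathcomp Require Import boolp classical_sets reals interval_inference.
From mathcomp Require Import lra.
Set Implicit Arguments.
Unset Strict Implicit.

Import Order.TTheory GRing.Theory Num.Theory.
Local Open Scope ring_scope.

(** The value of the objective at a feasible point depends only on the weights.
    When [A] lies below [B], the two endpoint gaps [lo B - lo A] and [hi B - hi A] are
    nonnegative; taken in increasing order they are the endpoints of one
    interval, which is used as [sl] or as [su] according to which gap is
    smaller (subtracting an interval exchanges its endpoints), while the other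
    slack is [0].  So [A + sl = B - su] is solvable with complementary slacks
    exactly when [A] lies below [B] ([KCle_slacksP]), and then the endpoints of
    the slacks add up to the total gap [total B - total A] ([slacks_total]).
    This one equation covers inputs ([A] the combination, [B] the data of the
    unit) as well as outputs ([A] the data of the unit, [B] the combination).

    Projecting on the weights, the feasible points become the convex
    combinations that dominate the unit ([feasible_dominating],
    [dominating_feasible]), and the objective becomes a sum of normalised total
    gaps ([objective_excess]).  This sum is nonnegative and vanishes only if the
    combination coincides with the unit ([excess_ge0], [excess_eq0P]).
    Efficiency says that every dominating combination coincides with the unit
    ([efficientP]), that is, that the excess never becomes positive; as it is
    [0] for the unit itself, this means that its maximum is [0]. *)

(** * Splitting the gap between two intervals into slacks *)

Section IntervalSlacks.
Context {R : realType}.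
Implicit Types A B sl su : KC R.

Definition total A : R := lo A + hi A.

Lemma KCposP A : KCpos A <-> 0 <= lo A.
Proof.
split=> [/andP[]//|h]; apply/andP; split=> //.
exact: le_trans h (le_lo_hi A).
Qed.

Lemma KCle_refl A : KCle A A.
Proof. by rewrite /KCle !lexx. Qed.

Lemma KCle_trans B A C : KCle A B -> KCle B C -> KCle A C.
Proof.
move=> /andP[lAB hAB] /andP[lBC hBC].
by rewrite /KCle (le_trans lAB lBC) (le_trans hAB hBC).
Qed.

Lemma KCle_anti A B : KCle A B -> KCle B A -> A = B.
Proof.
move=> /andP[lAB hAB] /andP[lBA hBA].
by apply: KC_eq; apply/le_anti/andP.
Qed.

Lemma KCle_total A B : KCle A B -> total A <= total B.
Proof. by move=> /andP[? ?]; exact: lerD. Qed.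

(** Under domination both endpoint gaps are nonnegative, so their sum controls
    each of them: the scalar [total] detects equality. *)
Lemma KCle_total_eq A B : KCle A B -> total A = total B -> A = B.
Proof.
by rewrite /total => /andP[lAB hAB] e; apply: KC_eq; lra.
Qed.

Lemma KCpos_total_gt0 A : KCpos A -> total A != 0 -> 0 < total A.
Proof.
move=> /KCposP l0 n0; rewrite lt_neqAle eq_sym n0.
exact: addr_ge0 l0 (le_trans l0 (le_lo_hi A)).
Qed.

Lemma KCmul0l A : KCmul (KCpt 0) A = KCset (KCpt 0).
Proof.
apply/seteqP; split=> [_ [a /= a0 [b _ <-]]|c /= c0].
  move: a0; rewrite /KCset /= !in_itv /= -!eq_le => /eqP <-.
  by rewrite mul0r.
move: (c0); rewrite /KCset /= in_itv /= -eq_le => /eqP <-.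
exists 0; first by rewrite /KCset /= in_itv /= lexx.
exists (lo A); last by rewrite mul0r.
by rewrite /KCset /= in_itv /= lexx le_lo_hi.
Qed.

Lemma KCmulC A B : KCmul A B = KCmul B A.
Proof.
by apply/seteqP; split=> _ [a ha [b hb <-]]; exists b => //; exists a => //;
  rewrite mulrC.
Qed.

Lemma slacks_eqP A B sl su : A + sl = KCsub B su <->
  lo A + lo sl = lo B - hi su /\ hi A + hi sl = hi B - lo su.
Proof.
by split=> [e|[el eh]]; [split; [have := congr1 lo e | have := congr1 hi e]
  | apply: KC_eq].
Qed.

Lemma slacks_total A B sl su : A + sl = KCsub B su ->
  lo sl + lo su + hi sl + hi su = total B - total A.
Proof. by rewrite /total => /slacks_eqP[? ?]; lra. Qed.

Definition complementary_slacks A B sl su :=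
  [/\ KCpos sl, KCpos su, A + sl = KCsub B su
    & KCmul sl su = KCset (KCpt 0)].

(** The only obstacle to solving for a single slack is the order of its
    endpoints: [sl] needs the lower gap to be the smaller one, [su] the upper
    gap, and one of the two always holds. *)
Lemma KCle_slacksP A B :
  KCle A B <-> exists s : KC R * KC R, complementary_slacks A B s.1 s.2.
Proof.
split=> [/andP[lAB hAB]|[[sl su] [/andP[l1 h1] /andP[l2 h2] /slacks_eqP[e1 e2] _]]].
  have [le|/ltW le] := lerP (lo B - lo A) (hi B - hi A).
    exists (mkKC le, KCpt 0); split=> /=.
    - by apply/KCposP; rewrite /lo /= subr_ge0.
    - exact: KCle_refl.
    - by apply/slacks_eqP; split; rewrite /= /lo /hi /=; lra.
    - by rewrite KCmulC KCmul0l.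
  (* the lower gap is the larger one, so it has to be an upper endpoint *)
  exists (KCpt 0, mkKC le); split=> /=.
  - exact: KCle_refl.
  - by apply/KCposP; rewrite /lo /= subr_ge0.
  - by apply/slacks_eqP; split; rewrite /= /lo /hi /=; lra.
  - exact: KCmul0l.
move: l1 h1 l2 h2 e1 e2; rewrite [lo (KCpt 0)]/lo [hi (KCpt 0)]/hi /=.
by move=> *; apply/andP; split; lra.
Qed.

End IntervalSlacks.

(** * Nonnegative combinations of intervals *)

Section Combinations.
Context {R : realType} {n N : nat}.
Implicit Types (Z : 'I_N -> 'I_n -> KC R) (l : 'I_N -> {nonneg R}).

Lemma combination_pos Z l : (forall j i, KCpos (Z j i)) ->
  forall i, KCpos (combination l Z i).
Proof.
move=> hZ i; apply: (big_ind (fun A : KC R => KCpos A)).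
- exact: KCle_refl.
- by move=> A B /KCposP a0 /KCposP b0; apply/KCposP; exact: addr_ge0.
- by move=> j _; apply/KCposP; apply: mulr_ge0 => //; apply/KCposP.
Qed.

Definition unit_weight (p j : 'I_N) : {nonneg R} := (j == p)%:R%:nng.

Lemma sum_unit_weight p : \sum_(j < N) (unit_weight p j)%:num = 1 :> R.
Proof.
rewrite (bigD1 p) //= eqxx big1 ?addr0 // => j /negbTE jp.
by rewrite jp.
Qed.

Lemma combination_unit_weight p Z i : combination (unit_weight p) Z i = Z p i.
Proof.
rewrite /combination (bigD1 p) //= big1 ?addr0 => [|j jp].
  by apply: KC_eq; rewrite /lo /hi /= eqxx mul1r.
by apply: KC_eq; rewrite /lo /hi /= (negbTE jp) mul0r.
Qed.

End Combinations.

(** * Dominating combinations and the objective *)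

(** Normalised gaps are nonnegative terms over positive denominators, hence
    their sum can vanish only termwise. *)
Lemma sum_gap_ge0 (R : realType) n (A B : 'I_n -> KC R) (d : 'I_n -> R) :
  (forall i, 0 < d i) -> KCvle A B ->
  0 <= \sum_(i < n) (total (B i) - total (A i)) / d i.
Proof.
move=> d0 AB; apply: sumr_ge0 => i _; apply: divr_ge0; last exact: ltW.
by rewrite subr_ge0 KCle_total.
Qed.

Lemma sum_gap_eq0 (R : realType) n (A B : 'I_n -> KC R) (d : 'I_n -> R) :
  (forall i, 0 < d i) -> KCvle A B ->
  \sum_(i < n) (total (B i) - total (A i)) / d i = 0 -> A = B.
Proof.
move=> d0 AB /eqP; rewrite psumr_eq0; last first.
  move=> i _; apply: divr_ge0; last exact: ltW.
  by rewrite subr_ge0 KCle_total.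
move=> /allP e; apply: funext => i; apply: KCle_total_eq => //.
have := e i (mem_index_enum i).
by rewrite /= mulf_eq0 invr_eq0 (gt_eqF (d0 i)) orbF subr_eq0 => /eqP.
Qed.

Section Domination.
Context {R : realType} {M S N : nat}.
Variables (X : 'I_N -> 'I_M -> KC R) (Y : 'I_N -> 'I_S -> KC R) (p : 'I_N).
Implicit Types (l : 'I_N -> {nonneg R}) (v : @EINL_var R M S N).

Definition dominating l :=
  [/\ \sum_(j < N) (l j)%:num = 1, KCvle (combination l X) (X p)
    & KCvle (Y p) (combination l Y)].

Lemma dominating_unit_weight : dominating (unit_weight p).
Proof.
by split=> [|i|r]; rewrite ?sum_unit_weight ?combination_unit_weight ?KCle_refl.
Qed.

(** A point of the production set that dominates the unit lies between the unit
    and the combination witnessing its membership, and this combination is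
    itself a point of the set; so only combinations need to be tested. *)
Lemma efficientP :
  (forall j i, KCpos (X j i)) -> (forall j r, KCpos (Y j r)) ->
  efficient X Y p <-> forall l, dominating l ->
    combination l X = X p /\ combination l Y = Y p.
Proof.
move=> hX hY; split=> [eff l [l1 lX lY]|eff x y [_ [_ [l [l1 lX lY]]]] /= xX Yy].
  suff inT : T_IDEA X Y (combination l X, combination l Y).
    by have /pair_equal_spec := eff _ _ inT lX lY.
  split; first exact: combination_pos.
  split; first exact: combination_pos.
  by exists l; split=> // ?; exact: KCle_refl.
have [| eX eY] := eff l.
  by split=> // i; [exact: KCle_trans (lX i) (xX i)
                  | exact: KCle_trans (Yy i) (lY i)].
move: lX lY; rewrite eX eY => lX lY.
by congr (_, _); apply: funext => i; exact: KCle_anti.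
Qed.

(** For the outputs the unit plays the role of the smaller interval, so the
    constraint has to be read from right to left. *)
Lemma feasible_dominating v : EINL_feasible X Y p v -> dominating (lam v).
Proof.
move=> [l1 [px py] ex ey [mx my]]; split=> // i; apply/KCle_slacksP.
- have [? ?] := px i; exists (slx v i, sux v i).
  by split; [| | exact: ex | exact: mx].
- have [? ?] := py i; exists (sly v i, suy v i).
  by split; [| | rewrite -ey | exact: my].
Qed.

Lemma dominating_feasible l : dominating l ->
  exists2 v, EINL_feasible X Y p v & lam v = l.
Proof.
move=> [l1 lX lY].
have [s hs] := choice (fun i => (KCle_slacksP _ _).1 (lX i)).
have [t ht] := choice (fun r => (KCle_slacksP _ _).1 (lY r)).
exists (MkEINL l (fun i => (s i).1) (fun i => (s i).2)
               (fun r => (t r).1) (fun r => (t r).2)) => //.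
split=> //=.
- by split=> i; [have [] := hs i | have [] := ht i].
- by move=> i; have [] := hs i.
- by move=> r; have [] := ht r.
- by split=> i; [have [] := hs i | have [] := ht i].
Qed.

Definition excess l : R :=
  \sum_(i < M) (total (X p i) - total (combination l X i)) / total (X p i) +
  \sum_(r < S) (total (combination l Y r) - total (Y p r)) / total (Y p r).

Lemma objective_excess v : EINL_feasible X Y p v ->
  EINL_objective X Y p v = excess (lam v).
Proof.
move=> [_ _ ex ey _]; congr (_ + _); apply: eq_bigr => i _; congr (_ / _).
  exact: slacks_total.
by apply: slacks_total; rewrite -ey.
Qed.

Hypotheses (dX : forall i, 0 < total (X p i)) (dY : forall r, 0 < total (Y p r)).

Lemma excess_ge0 l : dominating l -> 0 <= excess l.
Proof. by move=> [_ lX lY]; apply: addr_ge0; exact: sum_gap_ge0. Qed.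

Lemma excess_eq0P l : dominating l ->
  excess l = 0 <-> combination l X = X p /\ combination l Y = Y p.
Proof.
move=> [_ lX lY]; split=> [/eqP|[eX eY]].
  rewrite paddr_eq0 ?sum_gap_ge0 // => /andP[/eqP eX /eqP eY].
  by split; [apply: sum_gap_eq0 eX | apply/esym; apply: sum_gap_eq0 eY].
by rewrite /excess eX eY !big1 ?addr0 // => i _; rewrite subrr mul0r.
Qed.

End Domination.

Theorem theorem3 (R : realType) (M S N : nat)
  (X : 'I_N -> 'I_M -> KC R) (Y : 'I_N -> 'I_S -> KC R) (p : 'I_N)
  (hX : forall j i, KCpos (X j i)) (hY : forall j r, KCpos (Y j r))
  (dX : forall i, lo (X p i) + hi (X p i) != 0)
  (dY : forall r, lo (Y p r) + hi (Y p r) != 0) :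
  efficient X Y p <-> is_EI X Y p 0.
Proof.
have tX i : 0 < total (X p i) by exact: KCpos_total_gt0 (hX p i) (dX i).
have tY r : 0 < total (Y p r) by exact: KCpos_total_gt0 (hY p r) (dY r).
apply: iff_trans (efficientP p hX hY) _; split=> [eff|[_ ub] l dl].
  have excess0 l : dominating X Y p l -> excess X Y p l = 0.
    by move=> dl; apply/(excess_eq0P tX tY dl); exact: eff.
  split=> [|_ [v fv <-]].
    have du := dominating_unit_weight X Y p.
    have [v fv lv] := dominating_feasible du.
    by exists v => //; rewrite objective_excess // lv excess0.
  by rewrite objective_excess // excess0 //; exact: feasible_dominating.
apply/(excess_eq0P tX tY dl)/le_anti; rewrite excess_ge0 // andbT.
have [v fv <-] := dominating_feasible dl.
by rewrite -objective_excess //; apply: ub; exists v.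
Qed.
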